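(* Let $(E,\nabla)$ be a discrete vector bundle with connection over a locally ordered simplicial complex $X$ with a fixed choice of gauge, let $d$ denote the exterior covariant derivative of the trivial connection, and let $A:=d_\nabla-d$ be the discrete connection 1-form, i.e. the homomorphism-valued 1-cochain $A\in C^1(X;\mathrm{Hom}(E))$ with values $A_{ij}=U_{ij}-\mathrm{Id}$ on edges $[i,j]$. Then: (1) The covariant derivative is determined by $A$ as $d_\nabla=d+A$, i.e. $d_\nabla\alpha=d\alpha+A\smile\alpha$ for all $\alpha\in C^k(X;E)$ and all $k\ge 0$. (2) For every order-preserving simplicial map $f\colon Y\to X$ of locally ordered simplicial complexes, $A$ pulls back to a connection 1-form: $f^*A$ is the discrete connection 1-form of $(f^*E,f^*\nabla)$ (with respect to the pulled-back gauge). (3) The curvature satisfies $F=dA+A\smile A$, and the Bianchi identity $(d+A)F=0$ holds, where $(d+A)F$ means the covariant exterior derivative $d_{\nabla^{\mathrm{Hom}}}F$ on homomorphism-valued cochains induced by the connection $d_\nabla=d+A$. (4) Under a gauge transformation $g$ of the discrete vector bundle with connection, $A$ transforms as $A\mapsto gAg^{-1}-dg\,g^{-1}$ and the curvature transforms as $F\mapsto gFg^{-1}$.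
   Context: A locally ordered simplicial complex $X$ is a finite abstract simplicial complex together with a reflexive antisymmetric relation $\le$ on its vertex set that restricts to a total order on the vertices of each simplex. A $k$-simplex with ordered vertices abbreviated $0<1<\dots<k$ is written $[0,\dots,k]$; a hat denotes omission. An order-preserving simplicial map is a map of vertices sending simplices to simplices with $f(v)\le f(w)$ whenever $v\le w$. A (real or complex) discrete vector bundle with connection $(E,\nabla)$ over $X$ consists of a finite-dimensional vector space $E_i$ for each vertex $i$ and an invertible linear map $U_{ji}\colon E_i\to E_j$ for each edge $\{i,j\}$, with $U_{ij}=U_{ji}^{-1}$. A choice of gauge is a choice of isomorphism of each fiber $E_i$ with $\mathbb{R}^n$ (or $\mathbb{C}^n$), where $n$ is the rank (constant on each connected component of $X$); fibers over the vertices of an edge are thereby identified and the $U_{ij}$ become matrices in $\mathrm{GL}_n$. The trivial connection has all parallel transports equal to the identity. $C^k(X;E)$: cochains $\alpha$ assigning to each $k$-simplex $[0,\dots,k]$ a vector $\langle\alpha,[0,\dots,k]\rangle\in E_0$. $C^k(X;\mathrm{Hom}(E))$: cochains $B$ assigning to each $[0,\dots,k]$ a linear map $\langle B,[0,\dots,k]\rangle\colon E_k\to E_0$. Covariant exterior derivatives, for a connection with transports $U$: for $\alpha\in C^k(X;E)$, $$\langle d_\nabla\alpha,[0,\dots,k+1]\rangle=U_{01}\langle\alpha,[1,\dots,k+1]\rangle+\sum_{i=1}^{k+1}(-1)^i\langle\alpha,[0,\dots,\hat i,\dots,k+1]\rangle,$$ and for $B\in C^k(X;\mathrm{Hom}(E))$,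 $$\langle d_{\nabla^{\mathrm{Hom}}}B,[0,\dots,k+1]\rangle=U_{01}\langle B,[1,\dots,k+1]\rangle+\sum_{i=1}^{k}(-1)^i\langle B,[0,\dots,\hat i,\dots,k+1]\rangle+(-1)^{k+1}\langle B,[0,\dots,k]\rangle U_{k,k+1}.$$ The symbol $d$ denotes these same operators for the trivial connection (all $U=\mathrm{Id}$), on $E$-valued cochains and on homomorphism-valued cochains respectively; so $dA$ and $dg$ use the second formula. Cup products: $\langle B\smile\alpha,[0,\dots,k+l]\rangle=\langle B,[0,\dots,k]\rangle\langle\alpha,[k,\dots,k+l]\rangle$ for $B\in C^k(X;\mathrm{Hom}(E))$, $\alpha\in C^l(X;E)$, and $\langle B\smile D,[0,\dots,k+l]\rangle=\langle B,[0,\dots,k]\rangle\circ\langle D,[k,\dots,k+l]\rangle$ for $B\in C^k(X;\mathrm{Hom}(E))$, $D\in C^l(X;\mathrm{Hom}(E))$. The curvature $F\in C^2(X;\mathrm{Hom}(E))$ has values $\langle F,[0,1,2]\rangle=U_{01}U_{12}-U_{02}$, and represents $d_\nabla\circ d_\nabla$. Pullback: $f^*(E,\nabla)$ over $Y$ has fibers $(f^*E)_i=E_{f(i)}$ and transports $U_{f(i)f(j)}$ on edges with $f(i)\neq f(j)$, and the identity on edges with $f(i)=f(j)$. For a homomorphism-valued $k$-cochain $B$, $\langle f^*B,[0,\dots,k]\rangle=\langle B,[f(0),\dots,f(k)]\rangle$ if $f([0,\dots,k])$ is a $k$-simplex of $X$, and $0$ otherwise. A gauge transformation $g$ is a choice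 of $g_i\in\mathrm{GL}_n$ at each vertex $i$, viewed as $g\in C^0(X;\mathrm{Hom}(E))$, with $g^{-1}$ the cochain of inverses; it takes the connection with transports $U_{ij}$ to the one with transports $U'_{ij}=g_iU_{ij}g_j^{-1}$. Juxtaposition such as $gAg^{-1}$, $dg\,g^{-1}$, $gFg^{-1}$ denotes cup product of homomorphism-valued cochains. *)

(* Defs.v *)
From HB Require Import structures.
From mathcomp Require Import all_boot all_order all_algebra.

Set Implicit Arguments.
Unset Strict Implicit.
Unset Printing Implicit Defensive.

Import GRing.Theory.
Local Open Scope ring_scope.

(** * Locally ordered simplicial complexes *)

Record lo_complex := LoComplex {
  vertex :> finType;
  simplices : {set {set vertex}};
  vle : rel vertex;
  simplices_neq0 : set0 \notin simplices;
  simplices_vertex : forall v, [set v] \in simplices;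
  simplices_face : forall S T : {set vertex},
    S \in simplices -> T \subset S -> T != set0 -> T \in simplices;
  vle_refl : reflexive vle;
  vle_anti : antisymmetric vle;
  vle_total : forall S, S \in simplices -> {in S &, total vle};
  vle_trans : forall S, S \in simplices -> {in S & &, transitive vle}
}.

Definition vlt (X : lo_complex) : rel X := fun u v => (u != v) && vle u v.

Definition edge (X : lo_complex) : rel X :=
  fun u v => (u != v) && ([set u; v] \in simplices X).

Definition is_simplex (X : lo_complex) (k : nat) (v w : X)
    (s : {ffun 'I_k.+1 -> X}) : bool :=
  [&& s ord0 == v, s ord_max == w,
      [forall i : 'I_k.+1, forall j : 'I_k.+1, (i < j)%N ==> vlt (s i) (s j)]
    & [set s i | i : 'I_k.+1] \in simplices X].

(* The k-simplices [s 0, ..., s k], listed in increasing order, whose first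
   vertex is v and whose last vertex is w.  The end vertices are indices of the
   type, so that a cochain can take its values in a type depending on them. *)
Record simplex (X : lo_complex) (k : nat) (v w : X) := Simplex {
  vert :> {ffun 'I_k.+1 -> X};
  simplexP : is_simplex v w vert
}.

HB.instance Definition _ (X : lo_complex) (k : nat) (v w : X) :=
  [isSub for @vert X k v w].

Lemma is_simplex_sub (X : lo_complex) (k m : nat) (v w v' w' : X)
    (s : simplex k v w) (h : 'I_m.+1 -> 'I_k.+1) :
  {homo h : i j / (i < j)%N} -> s (h ord0) = v' -> s (h ord_max) = w' ->
  is_simplex v' w' [ffun j => s (h j)].
Proof.
case: s => s /= /and4P[_ _ /forallP s_lt sX] h_lt <- <-.
apply/and4P; split; rewrite ?ffunE //.
  apply/forallP => i; apply/forallP => j; apply/implyP => lt_ij.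
  by rewrite !ffunE; apply: (implyP (forallP (s_lt _) _)); apply: h_lt.
apply: (simplices_face sX).
  by apply/subsetP => _ /imsetP[i _ ->]; rewrite ffunE; apply: imset_f.
by apply/set0Pn; exists (s (h ord0)); apply/imsetP; exists ord0; rewrite ?ffunE.
Qed.

Lemma simplex_first (X : lo_complex) (k : nat) (v w : X) (s : simplex k v w) :
  s ord0 = v.
Proof. by case: s => s /= /and4P[/eqP]. Qed.

Lemma simplex_last (X : lo_complex) (k : nat) (v w : X) (s : simplex k v w) :
  s ord_max = w.
Proof. by case: s => s /= /and4P[_ /eqP]. Qed.

Lemma simplex0_ends (X : lo_complex) (v w : X) (s : simplex 0 v w) : v = w.
Proof.
have e : ord_max = ord0 :> 'I_1 by apply/val_inj.
by have := simplex_last s; rewrite e simplex_first.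
Qed.

Definition sub_simplex (X : lo_complex) (k m : nat) (v w v' w' : X)
    (s : simplex k v w) (h : 'I_m.+1 -> 'I_k.+1)
    (h_lt : {homo h : i j / (i < j)%N})
    (hv : s (h ord0) = v') (hw : s (h ord_max) = w') : simplex m v' w' :=
  Simplex (is_simplex_sub h_lt hv hw).

Lemma lift_homo (k : nat) (i : 'I_k.+2) : {homo lift i : j l / (j < l)%N}.
Proof.
move=> j l /= lt_jl; rewrite /bump -addnS leq_add //.
by case: (leqP i j) => // /leq_trans-> //; apply: ltnW.
Qed.

Section Faces.
Variables (X : lo_complex) (k : nat) (v w : X) (s : simplex k.+1 v w).

Fact face_first_hv : s (lift ord0 ord0) = s (inord 1).
Proof. by congr (s _); apply/val_inj; rewrite /= inordK. Qed.

Fact face_first_hw : s (lift ord0 ord_max) = w.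
Proof. by rewrite -[RHS](simplex_last s); congr (s _); apply/val_inj. Qed.

(* [1, ..., k+1] *)
Definition face_first : simplex k (s (inord 1)) w :=
  sub_simplex (@lift_homo k ord0) face_first_hv face_first_hw.

Fact face_last_hv : s (lift ord_max ord0) = v.
Proof. by rewrite -[RHS](simplex_first s); congr (s _); apply/val_inj. Qed.

Fact face_last_hw : s (lift ord_max ord_max) = s (inord k).
Proof.
by congr (s _); apply/val_inj; rewrite /= inordK // /bump ltnn.
Qed.

(* [0, ..., k] *)
Definition face_last : simplex k v (s (inord k)) :=
  sub_simplex (@lift_homo k ord_max) face_last_hv face_last_hw.

Fact face_inner_hv (i : 'I_k) : s (lift (inord i.+1) ord0) = v.
Proof.
rewrite -[RHS](simplex_first s); congr (s _); apply/val_inj.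
by rewrite /= inordK // ltnS ltnW // ltnS.
Qed.

Fact face_inner_hw (i : 'I_k) : s (lift (inord i.+1) ord_max) = w.
Proof.
rewrite -[RHS](simplex_last s); congr (s _); apply/val_inj.
by rewrite /= inordK /bump ?ltn_ord // ltnS ltnW // ltnS.
Qed.

(* The vertex of index i+1 is omitted: 1 <= i+1 <= k. *)
Definition face_inner (i : 'I_k) : simplex k v w :=
  sub_simplex (@lift_homo k (inord i.+1)) (face_inner_hv i) (face_inner_hw i).

End Faces.

Section FrontBack.
Variables (X : lo_complex) (k l : nat) (v w : X) (s : simplex (k + l) v w).

Let front_idx (i : 'I_k.+1) : 'I_(k + l).+1 := inord i.
Let back_idx (i : 'I_l.+1) : 'I_(k + l).+1 := inord (k + i).

Fact val_front_idx i : front_idx i = i :> nat.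
Proof. by rewrite inordK // ltnS (leq_trans _ (leq_addr _ _)) // -ltnS. Qed.

Fact val_back_idx i : back_idx i = (k + i)%N :> nat.
Proof. by rewrite inordK // ltnS leq_add2l -ltnS. Qed.

Fact front_homo : {homo front_idx : i j / (i < j)%N}.
Proof. by move=> i j; rewrite !val_front_idx. Qed.

Fact back_homo : {homo back_idx : i j / (i < j)%N}.
Proof. by move=> i j; rewrite !val_back_idx ltn_add2l. Qed.

Fact front_hv : s (front_idx ord0) = v.
Proof.
by rewrite -[RHS](simplex_first s); congr (s _); apply/val_inj; apply: val_front_idx.
Qed.

Fact back_hv : s (back_idx ord0) = s (inord k).
Proof. by rewrite /back_idx addn0. Qed.

Fact back_hw : s (back_idx ord_max) = w.
Proof.
by rewrite -[RHS](simplex_last s); congr (s _); apply/val_inj; apply: val_back_idx.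
Qed.

(* [0, ..., k] *)
Definition front : simplex k v (s (inord k)) :=
  sub_simplex front_homo front_hv erefl.

(* [k, ..., k+l] *)
Definition back : simplex l (s (inord k)) w :=
  sub_simplex back_homo back_hv back_hw.

End FrontBack.

(** * Bundles with connection and gauges *)

Definition identify (K : fieldType) (I : Type) (E : I -> vectType K) (i j : I)
    (e : i = j) : 'Hom(E j, E i) :=
  match e in _ = j' return 'Hom(E j', E i) with erefl => \1%VF end.

(* Parallel transports U i j : E j -> E i; only the values on edges are ever
   used, and no assumption is made on the other ones. *)
Definition transports (K : fieldType) (X : lo_complex) (E : X -> vectType K) :=
  forall i j : X, 'Hom(E j, E i).

(* As [edge] is symmetric, [transportVK] makes U i j and U j i inverse to each
   other on both sides. *)
Record connection (K : fieldType) (X : lo_complex) (E : X -> vectType K) :=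
  Connection {
    transport :> transports E;
    transportVK : forall i j : X,
      edge i j -> (transport i j \o transport j i)%VF = \1%VF
  }.

(* The rank at i is \dim {:E i}; invertibility of the transports forces it to be
   constant on connected components. *)
Record gauge (K : fieldType) (X : lo_complex) (E : X -> vectType K) := Gauge {
  gauge_iso :> forall i : X, 'Hom(E i, 'cV[K]_(\dim {:E i}));
  gauge_bij : forall i : X, bijective (gauge_iso i)
}.

(* The trivial connection is the identity in the gauge.  For the endpoints of an
   edge the two ranks are equal and conform_mx is the resulting cast; the default
   value 0 is never reached. *)
Definition trivial_transport (K : fieldType) (X : lo_complex)
    (E : X -> vectType K) (phi : gauge E) : transports E :=
  fun i j =>
    ((phi i)^-1
       \o linfun (conform_mx (0 : 'cV[K]_(\dim {:E i}))) \o phi j)%VF.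

(** * Cochains *)

Section Cochains.
Variables (K : fieldType) (X : lo_complex) (E : X -> vectType K).

Definition cochain (k : nat) := forall v w : X, simplex k v w -> E v.

Definition hom_cochain (k : nat) :=
  forall v w : X, simplex k v w -> 'Hom(E w, E v).

(* The summand of index k+1 of the alternating sum is written separately, because
   the last face has another last vertex. *)
Definition cov_d (U : transports E) (k : nat) (alpha : cochain k) :
    cochain k.+1 :=
  fun v w s =>
    U v (s (inord 1)) (alpha _ _ (face_first s))
    + \sum_(i < k) (-1) ^+ i.+1 *: alpha _ _ (face_inner s i)
    + (-1) ^+ k.+1 *: alpha _ _ (face_last s).

Definition cov_d_hom (U : transports E) (k : nat) (B : hom_cochain k) :
    hom_cochain k.+1 :=
  fun v w s =>
    (U v (s (inord 1)) \o B _ _ (face_first s))%VF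
    + \sum_(i < k) (-1) ^+ i.+1 *: B _ _ (face_inner s i)
    + (-1) ^+ k.+1 *: (B _ _ (face_last s) \o U (s (inord k)) w)%VF.

Definition cup (k l : nat) (B : hom_cochain k) (alpha : cochain l) :
    cochain (k + l) :=
  fun v w s => B _ _ (front s) (alpha _ _ (back s)).

Definition cup_hom (k l : nat) (B : hom_cochain k) (D : hom_cochain l) :
    hom_cochain (k + l) :=
  fun v w s => (B _ _ (front s) \o D _ _ (back s))%VF.

Definition vertex_cochain (a : forall i : X, 'End(E i)) : hom_cochain 0 :=
  fun v w s => (a v \o identify E (simplex0_ends s))%VF.

Definition curvature (U : transports E) : hom_cochain 2 :=
  fun v w s => (U v (s (inord 1)) \o U (s (inord 1)) w)%VF - U v w.

Definition connection_form (nabla : connection E) (phi : gauge E) :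
    hom_cochain 1 :=
  fun v w _ => transport nabla v w - trivial_transport phi v w.

End Cochains.

(** * Pullback *)

Record lo_map (Y X : lo_complex) := LoMap {
  lo_fun :> Y -> X;
  lo_simplices : forall S : {set Y},
    S \in simplices Y -> lo_fun @: S \in simplices X;
  lo_mono : {homo lo_fun : v w / vle v w}
}.

Definition pull_fiber (K : fieldType) (Y X : lo_complex) (f : lo_map Y X)
    (E : X -> vectType K) : Y -> vectType K :=
  fun i => E (f i).

Section Pullback.
Variables (K : fieldType) (Y X : lo_complex) (f : lo_map Y X).
Variable E : X -> vectType K.

Definition pull_transport (U : transports E) : transports (pull_fiber f E) :=
  fun i j =>
    match f i =P f j with
    | ReflectT e => identify E e
    | ReflectF _ => U (f i) (f j)
    end.

Fact pull_transportVK (nabla : connection E) (i j : Y) :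
  edge i j ->
  (pull_transport nabla i j \o pull_transport nabla j i)%VF = \1%VF.
Proof.
move=> /andP[_ ijY]; rewrite /pull_transport.
case: (f i =P f j) => [e|ne]; case: (f j =P f i) => [e'|ne'].
- rewrite (eq_irrelevance e' (esym e)) /pull_fiber; move: (f j) e e' => x e _.
  by case: _ / e; rewrite /= comp_lfun1l.
- by case: ne'.
- by case: ne.
have: edge (f i) (f j); last exact: transportVK.
apply/andP; split; first exact/eqP.
by rewrite -!imset_set1 -imsetU; apply: lo_simplices.
Qed.

Definition pull_connection (nabla : connection E) :
    connection (pull_fiber f E) :=
  Connection (pull_transportVK nabla).

Definition pull_gauge (phi : gauge E) : gauge (pull_fiber f E) :=
  @Gauge K Y (pull_fiber f E) (fun i => phi (f i)) (fun i => gauge_bij phi (f i)).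

(* insub tests whether [f (s 0), ..., f (s k)] is a k-simplex of X. *)
Definition pull_hom (k : nat) (B : hom_cochain E k) :
    hom_cochain (pull_fiber f E) k :=
  fun v w s =>
    match (insub [ffun i => f (s i)] : option (simplex k (f v) (f w))) with
    | Some fs => B (f v) (f w) fs
    | None => 0
    end.

End Pullback.

(** * Gauge transformations *)

Record gauge_transformation (K : fieldType) (X : lo_complex)
    (E : X -> vectType K) := GaugeTransformation {
  gt_mx :> forall i : X, 'M[K]_(\dim {:E i});
  gt_unit : forall i : X, gt_mx i \in unitmx
}.

Section GaugeAction.
Variables (K : fieldType) (X : lo_complex) (E : X -> vectType K).
Variables (phi : gauge E) (g : gauge_transformation E).

(* The endomorphism of E i with matrix M in the gauge phi. *)
Definition gauge_end (i : X) (M : 'M[K]_(\dim {:E i})) : 'End(E i) :=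
  ((phi i)^-1 \o linfun (mulmx M : 'cV_(_) -> 'cV_(_)) \o phi i)%VF.

Definition gt_end (i : X) : 'End(E i) := gauge_end (g i).
Definition gt_end_inv (i : X) : 'End(E i) := gauge_end (invmx (g i)).

Definition gt_cochain : hom_cochain E 0 := vertex_cochain gt_end.
Definition gt_cochain_inv : hom_cochain E 0 := vertex_cochain gt_end_inv.

Definition gt_transport (U : transports E) : transports E :=
  fun i j => (gt_end i \o U i j \o gt_end_inv j)%VF.

Lemma gauge_end_mul (i : X) (M N : 'M[K]_(\dim {:E i})) :
  (gauge_end M \o gauge_end N)%VF = gauge_end (M *m N).
Proof.
have phiK : cancel (phi i)^-1%VF (phi i).
  move=> x; have [psi _ psiK] := gauge_bij phi i.
  by apply: limg_lfunVK; rewrite -(psiK x) memv_img ?memvf.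
by apply/lfunP => x; rewrite /gauge_end !comp_lfunE /= phiK !(lfunE (mulmx _)) /= mulmxA.
Qed.

Lemma gauge_end1 (i : X) : gauge_end (1%:M : 'M[K]_(\dim {:E i})) = \1%VF.
Proof.
have ker0 : lker (phi i) == 0%VS.
  by apply/lker0P/bij_inj/gauge_bij.
by apply/lfunP => x; rewrite /gauge_end !comp_lfunE (lfunE (mulmx _)) /= mul1mx lker0_lfunK ?id_lfunE.
Qed.

Fact gt_transportVK (nabla : connection E) (i j : X) :
  edge i j -> (gt_transport nabla i j \o gt_transport nabla j i)%VF = \1%VF.
Proof.
move=> ij; have gVK l : (gt_end_inv l \o gt_end l)%VF = \1%VF.
  by rewrite gauge_end_mul mulVmx ?gt_unit // gauge_end1.
have gKV l : (gt_end l \o gt_end_inv l)%VF = \1%VF.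
  by rewrite gauge_end_mul mulmxV ?gt_unit // gauge_end1.
rewrite /gt_transport; move: (gt_end) (gt_end_inv) gVK gKV => a b baK abK.
rewrite -!comp_lfunA (comp_lfunA (b j)) baK comp_lfun1l.
by rewrite (comp_lfunA (transport nabla i j)) transportVK // comp_lfun1l.
Qed.

Definition gt_connection (nabla : connection E) : connection E :=
  Connection (gt_transportVK nabla).

End GaugeAction.

(* Main.v *)
Require Import Defs.
From HB Require Import structures.
From mathcomp Require Import all_boot all_order all_algebra.

Set Implicit Arguments.
Unset Strict Implicit.
Unset Printing Implicit Defensive.

Import GRing.Theory.
Local Open Scope ring_scope.

(** Write D for the transports of the trivial connection and U for those of
the given one, so that A = U - D on edges.

(1) Only the first term of the covariant derivative involves the transports,
and replacing D by U there adds A_01 alpha[1,...,k+1], which is the cup product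
of A and alpha.

(2) If f collapses the edge [v, w], then both transports of the pulled back
bundle are the identity of one fiber ([trivial_transport_loop]) and their
difference is 0; otherwise f [v, w] is an edge of X and both sides are
U - D on it.

(3) Substituting U = D + A in U_01 U_12 - U_02 gives
(D_01 D_12 - D_02) + (D_01 A_12 - A_02 + A_01 D_12) + A_01 A_12; the first
bracket vanishes because the trivial connection is flat
([trivial_transport_comp]), the second one is dA.  In the Bianchi identity the
eight terms, each a product of transports along a path from the last vertex to
the first one, cancel in pairs ([bianchi]).

(4) Here dg = D_01 g_1 - g_0 D_01, so that
g A g^-1 - dg g^-1 = g U g^-1 - g D g^-1 - D g g^-1 + g D g^-1 = g U g^-1 - D.
For the curvature, the inner factors g_1^-1 g_1 cancel.

Flatness of D rests on the ranks being equal along an edge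
([edge_dim]), for only then is the comparison of coordinate spaces through
conform_mx a genuine identification.  The rest of the work is with the fibers:
the end vertices of a face equal the expected vertices of the simplex only
propositionally, so that values of cochains must be compared through
[identify]. *)

(** * Identifications of equal fibers *)

Section Identify.
Variables (K : fieldType) (X : lo_complex) (E : X -> vectType K).

Lemma identify_id (i : X) (e : i = i) : identify E e = \1%VF.
Proof. by rewrite (eq_irrelevance e erefl). Qed.

(** The two forms below are those that arise from a cup product with a
0-cochain; the equations are variables, so that they can be eliminated. *)
Lemma hom_cochain_identl (k : nat) (B : hom_cochain E k) (v v' w : X)
    (s : simplex k v w) (s' : simplex k v' w) (e : v = v') :
  s =1 s' -> (identify E e \o B _ _ s')%VF = B _ _ s.
Proof.
case: v' / e s' => s' ss'; rewrite comp_lfun1l.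
by congr (B _ _ _); apply/val_inj/ffunP => i; rewrite /= ss'.
Qed.

Lemma hom_cochain_identr (k : nat) (B : hom_cochain E k) (v w x : X)
    (s : simplex k v w) (s' : simplex k v x) (e : x = w)
    (b : forall i, 'End(E i)) :
  s =1 s' -> (B _ _ s' \o (b x \o identify E e))%VF = (B _ _ s \o b w)%VF.
Proof.
case: w / e s => s ss'; rewrite comp_lfun1r; congr (_ \o _)%VF.
by congr (B _ _ _); apply/val_inj/ffunP => i; rewrite /= ss'.
Qed.

(** ** Cup products with 0-cochains *)

Lemma cup_vertexl (k : nat) (a : forall i, 'End(E i)) (B : hom_cochain E k)
    (v w : X) (s : simplex k v w) :
  cup_hom (vertex_cochain a) B (s : simplex (0 + k) v w) = (a v \o B _ _ s)%VF.
Proof.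
rewrite /cup_hom /vertex_cochain -comp_lfunA; congr (_ \o _)%VF.
apply: hom_cochain_identl => i; rewrite /= ffunE; congr (s _).
by apply: esym; apply: inord_val.
Qed.

(** As k + 0 is not convertible to k for a variable k, the same simplex occurs
twice, with the two dimensions; the hypothesis says that the vertices agree. *)
Lemma cup_vertexr (k : nat) (b : forall i, 'End(E i)) (B : hom_cochain E k)
    (v w : X) (s : simplex (k + 0) v w) (s' : simplex k v w) :
  (forall i : 'I_k.+1, s' i = s (inord i)) ->
  cup_hom B (vertex_cochain b) s = (B _ _ s' \o b w)%VF.
Proof.
move=> ss'; rewrite /cup_hom /vertex_cochain.
by apply: hom_cochain_identr => i; rewrite /= ffunE.
Qed.

Lemma cov_d_hom_vertex (U : transports E) (a : forall i, 'End(E i)) (v w : X)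
    (s : simplex 1 v w) :
  cov_d_hom U (vertex_cochain a) s = (U v w \o a w)%VF - (a v \o U v w)%VF.
Proof.
rewrite /cov_d_hom /vertex_cochain big_ord0 addr0 expr1 scaleN1r.
congr (_ - _).
  move: (simplex0_ends _); move: (s _) => x e.
  by case: _ / e; rewrite comp_lfun1r.
move: (simplex0_ends _); move: (s _) => x e.
by case: _ / e; rewrite comp_lfun1r.
Qed.

End Identify.

(** * The trivial connection *)

Lemma simplex_edge (X : lo_complex) (k : nat) (v w : X) (s : simplex k v w)
    (i j : 'I_k.+1) :
  (i < j)%N -> edge (s i) (s j).
Proof.
case: s => s /= /and4P[_ _ /forallP s_lt sX] lt_ij; apply/andP; split.
  by have /andP[] := implyP (forallP (s_lt i) j) lt_ij.
apply: (simplices_face sX); last by apply/set0Pn; exists (s i); rewrite set21.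
by apply/subsetP => _ /set2P[] ->; apply: imset_f.
Qed.

Lemma edgeC (X : lo_complex) : symmetric (@edge X).
Proof. by move=> i j; rewrite /edge eq_sym setUC. Qed.

(** The transport along an edge has a left inverse, hence is injective; as this
holds in both directions, the two fibers have the same dimension. *)
Lemma edge_dim (K : fieldType) (X : lo_complex) (E : X -> vectType K)
    (nabla : connection E) (i j : X) :
  edge i j -> \dim {:E i} = \dim {:E j}.
Proof.
have le_dim a b : edge a b -> (\dim {:E a} <= \dim {:E b})%N.
  move=> ab; have ker0 : lker (transport nabla b a) == 0%VS.
    apply/lker0P => x y /(congr1 (transport nabla a b)).
    by rewrite -!comp_lfunE transportVK // !id_lfunE.
  rewrite -(limg_dim_eq (f := transport nabla b a)) ?dimvS ?subvf //.
  by rewrite (eqP ker0) capv0.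
by move=> ij; apply/eqP; rewrite eqn_leq !le_dim // edgeC.
Qed.

Section ConformZero.
Variables (K : fieldType) (m n m' n' : nat).

(** Both branches of the definition are linear: a cast if the sizes agree, and
otherwise the default value, which is 0. *)
Fact conform_mx0_is_linear :
  linear (conform_mx (0 : 'M[K]_(m', n')) : 'M_(m, n) -> _).
Proof.
move=> a A B; have [[em en]|ne] := eqVneq (m, n) (m', n').
  by case: m' / em; case: n' / en; rewrite !conform_mx_id.
have conf0 C : conform_mx (0 : 'M[K]_(m', n')) (C : 'M_(m, n)) = 0.
  by rewrite nonconform_mx // -negb_and -xpair_eqE.
by rewrite !conf0 scaler0 addr0.
Qed.

HB.instance Definition _ :=
  GRing.isLinear.Build K 'M[K]_(m, n) 'M[K]_(m', n') *:%R
    (conform_mx (0 : 'M[K]_(m', n'))) conform_mx0_is_linear.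

End ConformZero.

Lemma conform_mx0_comp (K : fieldType) (m1 m2 m3 n : nat) (A : 'M[K]_(m3, n)) :
  m2 = m3 ->
  conform_mx (0 : 'M_(m1, n)) (conform_mx (0 : 'M_(m2, n)) A) = conform_mx 0 A.
Proof. by move=> e; case: m3 / e A => A; rewrite conform_mx_id. Qed.

Section TrivialConnection.
Variables (K : fieldType) (X : lo_complex) (E : X -> vectType K).
Variable phi : gauge E.

Lemma gauge_lker0 (i : X) : lker (phi i) == 0%VS.
Proof. exact/lker0P/bij_inj/gauge_bij. Qed.

Lemma gauge_invK (i : X) : cancel (phi i)^-1%VF (phi i).
Proof.
move=> x; have [psi _ psiK] := gauge_bij phi i.
by apply: limg_lfunVK; rewrite -(psiK x) memv_img ?memvf.
Qed.

Lemma trivial_transportE (i j : X) (x : E j) :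
  trivial_transport phi i j x = (phi i)^-1%VF (conform_mx 0 (phi j x)).
Proof. by rewrite !comp_lfunE (lfunE (conform_mx 0)). Qed.

Lemma trivial_transport_loop (i j : X) (e : i = j) :
  trivial_transport phi i j = identify E e.
Proof.
case: j / e; apply/lfunP => x.
by rewrite trivial_transportE conform_mx_id lker0_lfunK ?gauge_lker0 ?id_lfunE.
Qed.

(** Flatness: by equality of the ranks, the coordinates pass from l to j
unchanged.  If these ranks differed, they would become 0 there. *)
Lemma trivial_transport_comp (i j l : X) :
  \dim {:E j} = \dim {:E l} ->
  (trivial_transport phi i j \o trivial_transport phi j l)%VF
  = trivial_transport phi i l.
Proof.
move=> jl; apply/lfunP => x; rewrite comp_lfunE !trivial_transportE gauge_invK.
by rewrite conform_mx0_comp.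
Qed.

End TrivialConnection.

(** * The connection form and the covariant derivative *)

Lemma cov_d_connection_form (K : fieldType) (X : lo_complex)
    (E : X -> vectType K) (nabla : connection E) (phi : gauge E) (k : nat)
    (alpha : cochain E k) (v w : X) (s : simplex k.+1 v w) :
  cov_d nabla alpha s
  = cov_d (trivial_transport phi) alpha s
    + cup (connection_form nabla phi) alpha s.
Proof.
have -> : cup (connection_form nabla phi) alpha s
    = connection_form nabla phi (@front X 1 k v w s) (alpha _ _ (face_first s)).
  congr (connection_form _ _ _ (alpha _ _ _)); apply/val_inj/ffunP => i.
  rewrite /= !ffunE; congr (s _); apply/val_inj.
  by rewrite /= inordK // add1n ltnS.
rewrite /cov_d /connection_form add_lfunE opp_lfunE.
set a := transport nabla _ _ _; set b := trivial_transport _ _ _ _.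
by rewrite [RHS]addrC !addrA subrK.
Qed.

(** * Pullback *)

Section Pullback.
Variables (Y X : lo_complex) (f : lo_map Y X).

(** An order-preserving map can only fail to send an edge to an edge by
collapsing it. *)
Lemma image_is_simplex1 (v w : Y) (s : simplex 1 v w) :
  is_simplex (f v) (f w) [ffun i => f (s i)] = (f v != f w).
Proof.
have [s0 s1] := (simplex_first s, simplex_last s).
have lt01 : (@ord0 1 < @ord_max 1)%N by [].
apply/idP/idP => [/and4P[_ _ /forallP/(_ ord0)/forallP/(_ ord_max)]|ne].
  by rewrite !ffunE s0 s1 => /andP[].
case: (s) (s0) (s1) => t /= /and4P[_ _ /forallP t_lt tY] t0 t1.
apply/and4P; split; rewrite ?ffunE ?t0 ?t1 //.
  apply/forallP => i; apply/forallP => j; apply/implyP => lt_ij.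
  have [ei ej] : i = ord0 /\ j = ord_max.
    by case: i j lt_ij => [[|[|i]] // ?] [[|[|j]] // ?] _; split; apply/val_inj.
  rewrite !ffunE ei ej t0 t1 /vlt ne lo_mono // -t0 -t1.
  by have /andP[] := implyP (forallP (t_lt _) _) lt01.
rewrite (_ : [set _ | _ in _] = f @: [set t i | i : 'I_2]); last first.
  by rewrite -imset_comp; apply: eq_imset => i; rewrite ffunE.
exact: lo_simplices.
Qed.

Lemma pull_connection_form (K : fieldType) (E : X -> vectType K)
    (nabla : connection E) (phi : gauge E) (v w : Y) (s : simplex 1 v w) :
  pull_hom f (connection_form nabla phi) s
  = connection_form (pull_connection f nabla) (pull_gauge f phi) s.
Proof.
rewrite /connection_form /= /pull_transport /pull_hom.
rewrite -[trivial_transport (pull_gauge f phi) v w]/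
  (trivial_transport phi (f v) (f w)).
case: insubP => [fs|]; rewrite image_is_simplex1.
  by case: eqP.
by case: eqP => // e _; rewrite (trivial_transport_loop phi e) subrr.
Qed.

End Pullback.

(** * Curvature *)

Section Curvature.
Variables (K : fieldType) (X : lo_complex) (E : X -> vectType K).

Lemma curvature_form (nabla : connection E) (phi : gauge E) (v w : X)
    (s : simplex 2 v w) :
  let A := connection_form nabla phi in
  curvature nabla s = cov_d_hom (trivial_transport phi) A s + cup_hom A A s.
Proof.
move=> A; set D := trivial_transport phi.
rewrite /cov_d_hom /cup_hom /curvature big_ord1 expr1 scaleN1r sqrrN expr1n.
rewrite scale1r /A /connection_form -/D; set x := s (inord 1).
have flat : (D v x \o D x w)%VF = D v w.
  apply: trivial_transport_comp; apply: (edge_dim nabla).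
  rewrite -[X in edge _ X](simplex_last s); apply: simplex_edge.
  by rewrite inordK.
(* The values of A depend on the end vertices alone. *)
pose a i j : 'Hom(E j, E i) := transport nabla i j - D i j.
have UE i j : transport nabla i j = D i j + a i j by rewrite addrC subrK.
rewrite -!/(a _ _); clearbody a.
rewrite !UE -flat comp_lfunDl !comp_lfunDr.
rewrite -[X in X - _]addrA [X in X - _]addrC addrKA addrA.
by rewrite [LHS]addrAC [X in X + _]addrAC.
Qed.

(** The middle vertex is left free, to be given as a vertex of the simplex of
which s is a face. *)
Lemma curvatureE (U : transports E) (v w x : X) (s : simplex 2 v w) :
  s (inord 1) = x -> curvature U s = (U v x \o U x w)%VF - U v w.
Proof. by move <-. Qed.

Lemma bianchi (U : transports E) (v w : X) (s : simplex 3 v w) :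
  cov_d_hom U (curvature U) s = 0.
Proof.
set x := s (inord 1); set y := s (inord 2).
have vert_s (i j : 'I_4) : i = j :> nat -> s i = s j by move/val_inj->.
rewrite /cov_d_hom big_ord_recl big_ord1 /=.
(* The middle vertex is y in the faces [1,2,3] and [0,2,3], and x in the faces
[0,1,3] and [0,1,2]. *)
rewrite (@curvatureE U _ _ y (face_first s)); last first.
  by rewrite /= ffunE; apply: vert_s; rewrite /= /bump !inordK.
rewrite (@curvatureE U _ _ y (face_inner s _)); last first.
  by rewrite /= ffunE; apply: vert_s; rewrite /= /bump !inordK.
rewrite (@curvatureE U _ _ x (face_inner s _)); last first.
  by rewrite /= ffunE; apply: vert_s; rewrite /= /bump !inordK.
rewrite (@curvatureE U _ _ x (face_last s)); last first.
  by rewrite /= ffunE; apply: vert_s; rewrite /= /bump !inordK.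
rewrite -/x -/y.
rewrite !(comp_lfunDl, comp_lfunDr, comp_lfunNl, comp_lfunNr) !comp_lfunA.
rewrite expr1 sqrrN expr1n exprS sqrrN expr1n mulr1 !scaleN1r scale1r opprB.
by rewrite [_ + (_ - U v w)]addrC !subrKA subrr.
Qed.

End Curvature.

(** * Gauge transformations *)

Section GaugeTransformation.
Variables (K : fieldType) (X : lo_complex) (E : X -> vectType K).
Variables (phi : gauge E) (g : gauge_transformation E).

Lemma gt_endK (i : X) : (gt_end phi g i \o gt_end_inv phi g i)%VF = \1%VF.
Proof. by rewrite gauge_end_mul mulmxV ?gt_unit // gauge_end1. Qed.

Lemma gt_end_invK (i : X) : (gt_end_inv phi g i \o gt_end phi g i)%VF = \1%VF.
Proof. by rewrite gauge_end_mul mulVmx ?gt_unit // gauge_end1. Qed.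

(** In this form gAg^-1 and gFg^-1 become plain conjugations; the cochain is
evaluated on the same simplex in dimensions k and k + 0. *)
Lemma gt_conj_cochain (k : nat) (B : hom_cochain E k) (v w : X)
    (s : simplex (k + 0) v w) (s' : simplex k v w) :
  (forall i : 'I_k.+1, s' i = s (inord i)) ->
  cup_hom (cup_hom (gt_cochain phi g) B) (gt_cochain_inv phi g)
    (s : simplex (0 + k + 0) v w)
  = (gt_end phi g v \o B _ _ s' \o gt_end_inv phi g w)%VF.
Proof. by move=> ss'; rewrite (cup_vertexr _ _ ss') cup_vertexl. Qed.

Lemma gt_connection_form (nabla : connection E) (v w : X) (s : simplex 1 v w) :
  let A := connection_form nabla phi in
  let ginv := gt_cochain_inv phi g in
  connection_form (gt_connection phi g nabla) phi s
  = cup_hom (cup_hom (gt_cochain phi g) A) ginv s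
    - cup_hom (cov_d_hom (trivial_transport phi) (gt_cochain phi g)) ginv s.
Proof.
move=> A ginv; have ss (i : 'I_2) : s i = s (inord i) by rewrite inord_val.
rewrite (gt_conj_cochain _ ss) (cup_vertexr _ _ ss) cov_d_hom_vertex.
rewrite /A /connection_form /= /gt_transport.
set D := trivial_transport phi v w.
rewrite !(comp_lfunDl, comp_lfunDr, comp_lfunNl, comp_lfunNr).
rewrite -[(D \o _ \o _)%VF]comp_lfunA gt_endK comp_lfun1r.
by rewrite opprB addrA subrK.
Qed.

Lemma gt_curvature (nabla : connection E) (v w : X) (s : simplex 2 v w) :
  curvature (gt_connection phi g nabla) s
  = cup_hom (cup_hom (gt_cochain phi g) (curvature nabla))
      (gt_cochain_inv phi g) s.
Proof.
have ss (i : 'I_3) : s i = s (inord i) by rewrite inord_val.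
rewrite (gt_conj_cochain _ ss) /curvature /= /gt_transport.
set x := s (inord 1).
rewrite !(comp_lfunDl, comp_lfunDr, comp_lfunNl, comp_lfunNr).
(* Both factors are composites by definition; they are abstracted, so that
reassociation does not break them up. *)
have := gt_end_invK x; move: (gt_end phi g) (gt_end_inv phi g) => a b baK.
by rewrite !comp_lfunA -[(_ \o b x \o a x)%VF]comp_lfunA baK comp_lfun1r.
Qed.

End GaugeTransformation.

(** * Properties of the connection form *)

Theorem theorem1p7 (K : fieldType) (X : lo_complex) (E : X -> vectType K)
    (nabla : connection E) (phi : gauge E) :
  let d0 := trivial_transport phi in
  let A := connection_form nabla phi in
  let F := curvature nabla in
  [/\ forall (k : nat) (alpha : cochain E k) (v w : X) (s : simplex k.+1 v w),
        cov_d nabla alpha s = cov_d d0 alpha s + cup A alpha s,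
      forall (Y : lo_complex) (f : lo_map Y X) (v w : Y) (s : simplex 1 v w),
        pull_hom f A s
        = connection_form (pull_connection f nabla) (pull_gauge f phi) s,
      (forall (v w : X) (s : simplex 2 v w),
         F v w s = cov_d_hom d0 A s + cup_hom A A s)
      /\ (forall (v w : X) (s : simplex 3 v w), cov_d_hom nabla F s = 0)
    & forall g : gauge_transformation E,
        let nabla' := gt_connection phi g nabla in
        let g_ := gt_cochain phi g in
        let ginv := gt_cochain_inv phi g in
        (forall (v w : X) (s : simplex 1 v w),
           connection_form nabla' phi s
           = cup_hom (cup_hom g_ A) ginv s - cup_hom (cov_d_hom d0 g_) ginv s)
        /\ (forall (v w : X) (s : simplex 2 v w),
              curvature nabla' s = cup_hom (cup_hom g_ F) ginv s) ].
Proof.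
split.
- by move=> k alpha v w s; apply: cov_d_connection_form.
- by move=> Y f v w s; apply: pull_connection_form.
- by split=> v w s; [apply: curvature_form | apply: bianchi].
- by move=> g; split=> v w s; [apply: gt_connection_form | apply: gt_curvature].
Qed.
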